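(* Let $M$ be a strictly totally ordered monoid, let $R$ be a ring and let $I$ be a proper ideal of $R$ with $N_*(R)\subseteq I$. If $R/I$ is $M$-Armendariz and $I$ is a $2$-primal ring (regarded as a ring possibly without identity), then $R$ is a lower nil $M$-Armendariz ring.
   Context: Rings are associative with identity (an ideal is regarded as a ring possibly without identity). For a ring $T$, $N_*(T)$ denotes the prime radical (lower nilradical) of $T$ and $N(T)$ the set of nilpotent elements of $T$; $T$ is $2$-primal if $N_*(T)=N(T)$. A strictly totally ordered monoid is a monoid $M$ with a total order $\le$ such that for all $r_1,r_2,s\in M$, $r_1<r_2$ implies $r_1s<r_2s$ and $sr_1<sr_2$. $R[M]$ is the monoid ring of $M$ over $R$; for a subset $J\subseteq R$, $J[M]$ is the set of elements of $R[M]$ all of whose coefficients lie in $J$. Below, elements of $R[M]$ are written $\alpha=a_1g_1+\cdots+a_ng_n$ and $\beta=b_1h_1+\cdots+b_mh_m$ with $a_i,b_j\in R$, the $g_i\in M$ pairwise distinct and the $h_j\in M$ pairwise distinct. A ring $R$ is $M$-Armendariz if $\alpha\beta=0$ implies $a_ib_j=0$ for all $i,j$. A ring $R$ is lower nil $M$-Armendariz if $\alpha\beta\in N_*(R)[M]$ implies $a_ib_j\in N_*(R)$ for all $i,j$. *)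

(* Defs.v *)
From HB Require Import structures.
From mathcomp Require Import all_boot all_order all_algebra finmap.
From mathcomp Require Import boolp classical_sets.
From mathcomp.multinomials Require Import monalg.

Set Implicit Arguments.
Unset Strict Implicit.
Unset Printing Implicit Defensive.

Import Order.TTheory GRing.Theory.

Local Open Scope fset_scope.
Local Open Scope classical_set_scope.
Local Open Scope ring_scope.

HB.mixin Record isStrictlyOrderedMonoid (d : Order.disp_t) M
    of monoid.Monoid M & Order.Total d M := {
  ltM2r : forall s r1 r2 : M, (r1 < r2)%O -> (r1 * s < r2 * s)%O%g;
  ltM2l : forall s r1 r2 : M, (r1 < r2)%O -> (s * r1 < s * r2)%O%g
}.

#[short(type="strictlyOrderedMonoidType")]
HB.structure Definition StrictlyOrderedMonoid (d : Order.disp_t) :=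
  {M of isStrictlyOrderedMonoid d M & monoid.Monoid M & Order.Total d M}.

(* [monalg] puts a ring structure on [{malg R[M]}] only for monoids in which
   1 has no nontrivial factorisation and for nontrivial R. We keep its finitely
   supported functions and their additive structure, and define the convolution
   product on an alias, for arbitrary M and R. *)
Definition monoid_ring (R : pzRingType) (M : monoidType) : Type := {malg R[M]}.

Section MonoidRing.
Context (R : pzRingType) (M : monoidType).

HB.instance Definition _ := Choice.copy (monoid_ring R M) {malg R[M]}.
HB.instance Definition _ := GRing.Zmodule.copy (monoid_ring R M) {malg R[M]}.

Implicit Types (g : {malg R[M]}) (k : M).

Definition mr_one : {malg R[M]} := mkmalgU 1%g 1.

Definition mr_mul g1 g2 : {malg R[M]} :=
  \sum_(k1 <- msupp g1) \sum_(k2 <- msupp g2)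
    mkmalgU (k1 * k2)%g (g1@_k1 * g2@_k2).

Lemma mr_mulw (d1 d2 : {fset M}) g1 g2 :
  (msupp g1 `<=` d1)%fset -> (msupp g2 `<=` d2)%fset ->
  mr_mul g1 g2 = \sum_(k1 <- d1) \sum_(k2 <- d2)
    mkmalgU (k1 * k2)%g (g1@_k1 * g2@_k2).
Proof.
move=> le_d1 le_d2; rewrite /mr_mul (big_fset_incl _ le_d1) /=.
  apply/eq_bigr=> k1 _; apply/big_fset_incl => // k _ /mcoeff_outdom ->.
  by rewrite mulr0 monalgU0.
move=> k _ /mcoeff_outdom g1k.
by rewrite big1 => // k' _; rewrite g1k mul0r monalgU0.
Qed.

Lemma mr_mul0g : left_zero 0 mr_mul.
Proof. by move=> g; rewrite /mr_mul msupp0 big_seq_fset0. Qed.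

Lemma mr_mulg0 : right_zero 0 mr_mul.
Proof.
by move=> g; rewrite /mr_mul big1 // => k _; rewrite msupp0 big_seq_fset0.
Qed.

Lemma mr_mulUg c k g :
  mr_mul (mkmalgU k c) g = \sum_(k' <- msupp g) mkmalgU (k * k')%g (c * g@_k').
Proof.
rewrite (mr_mulw msuppU_le (fsubset_refl _)) big_seq_fset1.
by apply/eq_bigr => k' _; rewrite mcoeffUU.
Qed.

Lemma mr_mulgU c k g :
  mr_mul g (mkmalgU k c) = \sum_(k' <- msupp g) mkmalgU (k' * k)%g (g@_k' * c).
Proof.
rewrite (mr_mulw (fsubset_refl _) msuppU_le).
by apply/eq_bigr=> k' _; rewrite big_seq_fset1 mcoeffUU.
Qed.

Lemma mr_mulUU c1 c2 k1 k2 :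
  mr_mul (mkmalgU k1 c1) (mkmalgU k2 c2) = mkmalgU (k1 * k2)%g (c1 * c2).
Proof. by rewrite (mr_mulw msuppU_le msuppU_le) !big_seq_fset1 !mcoeffUU. Qed.

Lemma mr_mulDl : left_distributive mr_mul +%R.
Proof.
move=> g1 g2 g.
rewrite [in RHS](mr_mulw (fsubsetUl _ (msupp g2)) (fsubset_refl _)).
rewrite [in RHS](mr_mulw (fsubsetUr (msupp g1) _) (fsubset_refl _)).
rewrite (mr_mulw (msuppD_le _ _) (fsubset_refl _)).
rewrite -big_split /=; apply/eq_bigr=> k1 _.
rewrite -big_split /=; apply/eq_bigr=> k2 _.
by rewrite mcoeffD mulrDl monalgUD.
Qed.

Lemma mr_mulDr : right_distributive mr_mul +%R.
Proof.
move=> g g1 g2.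
rewrite [in RHS](mr_mulw (fsubset_refl _) (fsubsetUl _ (msupp g2))).
rewrite [in RHS](mr_mulw (fsubset_refl _) (fsubsetUr (msupp g1) _)).
rewrite (mr_mulw (fsubset_refl _) (msuppD_le _ _)).
rewrite -big_split /=; apply/eq_bigr=> k1 _.
rewrite -big_split /=; apply/eq_bigr=> k2 _.
by rewrite mcoeffD mulrDr monalgUD.
Qed.

Lemma mr_mul1g : left_id mr_one mr_mul.
Proof.
move=> g; rewrite mr_mulUg [RHS]monalgE.
by apply/eq_bigr=> k _; rewrite mul1r mul1g.
Qed.

Lemma mr_mulg1 : right_id mr_one mr_mul.
Proof.
move=> g; rewrite mr_mulgU [RHS]monalgE.
by apply/eq_bigr=> k _; rewrite mulr1 mulg1.
Qed.

Lemma mr_mulEl g1 g2 :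
  mr_mul g1 g2 = \sum_(k1 <- msupp g1) mr_mul (mkmalgU k1 g1@_k1) g2.
Proof. by apply/eq_bigr=> k _; rewrite mr_mulUg. Qed.

Lemma mr_mulEr g1 g2 :
  mr_mul g1 g2 = \sum_(k2 <- msupp g2) mr_mul g1 (mkmalgU k2 g2@_k2).
Proof.
by rewrite {1}/mr_mul exchange_big; apply/eq_bigr=> k _; rewrite mr_mulgU.
Qed.

Lemma mr_mulA : associative mr_mul.
Proof.
move=> g1 g2 g3.
rewrite [RHS](big_morph (mr_mul^~ _) (fun _ _ => mr_mulDl _ _ _) (mr_mul0g _)).
rewrite mr_mulEl; apply/eq_bigr=> k1 _.
rewrite [LHS](big_morph (mr_mul _) (fun _ _ => mr_mulDr _ _ _) (mr_mulg0 _)).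
rewrite [RHS](big_morph (mr_mul^~ _) (fun _ _ => mr_mulDl _ _ _) (mr_mul0g _)).
apply/eq_bigr=> k2 _.
rewrite [LHS](big_morph (mr_mul _) (fun _ _ => mr_mulDr _ _ _) (mr_mulg0 _)).
by rewrite mr_mulEr; apply/eq_bigr=> k3 _; rewrite !mr_mulUU mulrA mulgA.
Qed.

HB.instance Definition _ := GRing.Zmodule_isPzRing.Build (monoid_ring R M)
  mr_mulA mr_mul1g mr_mulg1 mr_mulDl mr_mulDr.

Definition mr_coef (k : M) (a : monoid_ring R M) : R := mcoeff k a.

Definition mr_over (J : set R) : set (monoid_ring R M) :=
  [set a | forall k, J (mr_coef k a)].

End MonoidRing.

(* Rings without identity are encoded as subsets S of an ambient ring R that
   are closed under subtraction and multiplication; the notions below only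
   depend on S with the induced operations, and S = setT gives back the notions
   for R itself. *)
Section Radical.
Context (R : pzRingType).
Implicit Types S A B P : set R.

Definition is_ideal S A : Prop :=
  [/\ A `<=` S,
      A 0,
      forall a b, A a -> A b -> A (a - b)
    & forall s a, S s -> A a -> A (s * a) /\ A (a * s)].

(* As P is additively closed, AB is contained in P as soon as all products
   a * b are. *)
Definition is_prime_ideal S P : Prop :=
  [/\ is_ideal S P,
      P <> S
    & forall A B, is_ideal S A -> is_ideal S B ->
        (forall a b, A a -> B b -> P (a * b)) -> A `<=` P \/ B `<=` P].

Definition prime_radical S : set R :=
  [set x | S x /\ forall P, is_prime_ideal S P -> P x].

Definition nilpotents S : set R :=
  [set x | S x /\ exists n, x ^+ n.+1 = 0].

Definition two_primal S : Prop := prime_radical S = nilpotents S.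

End Radical.

Record two_sided_ideal (R : pzRingType) := TwoSidedIdeal {
  ideal_set :> set R;
  ideal_setP : is_ideal setT ideal_set
}.

Section QuotientRing.
Context (R : pzRingType) (I : two_sided_ideal R).
Local Open Scope quotient_scope.

Definition ideal_pred : R -> bool := fun x => `[< ideal_set I x >].

Lemma ideal_pred_zmod_closed : zmod_closed ideal_pred.
Proof.
case: (ideal_setP I) => _ I0 IB _; split; first exact/asboolP.
by move=> x y /asboolP Ix /asboolP Iy; apply/asboolP/IB.
Qed.

HB.instance Definition _ :=
  GRing.isZmodClosed.Build R ideal_pred ideal_pred_zmod_closed.

Definition ideal_zmod : zmodClosed R := GRing.ZmodClosed.clone R ideal_pred _.

(* The library provides the additive quotient, but the ring structure only for
   commutative R. *)
Definition quotient_ring : Type := Quotient.quot ideal_zmod.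

HB.instance Definition _ := GRing.Zmodule.copy quotient_ring (Quotient.quot ideal_zmod).
HB.instance Definition _ :=
  EqQuotient.copy quotient_ring (Quotient.quot ideal_zmod).

Definition quot_one : quotient_ring := \pi_quotient_ring 1.
Definition quot_mul := lift_op2 quotient_ring *%R.

Lemma quot_eqE (x y : R) :
  (\pi_quotient_ring x = \pi_quotient_ring y) <-> ideal_set I (x - y).
Proof.
split=> [/eqP|Ixy]; first by rewrite -Quotient.idealrBE => /asboolP.
by apply/eqP; rewrite -Quotient.idealrBE; apply/asboolP.
Qed.

Lemma pi_quot_mul (x y : R) :
  quot_mul (\pi x) (\pi y) = \pi_quotient_ring (x * y).
Proof.
case: (ideal_setP I) => _ I0 IB IM; unlock quot_mul; apply/quot_eqE.
set x' := repr _; set y' := repr _.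
have Ix : ideal_set I (x' - x) by apply/quot_eqE; rewrite reprK.
have Iy : ideal_set I (y' - y) by apply/quot_eqE; rewrite reprK.
have -> : x' * y' - x * y = (x' - x) * y' - (- x) * (y' - y).
  by rewrite mulrBl mulNr opprK mulrBr addrA subrK.
by apply: IB; [apply: (IM y' _ _ Ix).2 | apply: (IM (- x) _ _ Iy).1].
Qed.

Lemma pi_quot_add (x y : R) :
  \pi_quotient_ring x + \pi_quotient_ring y = \pi_quotient_ring (x + y).
Proof. exact/esym/(@Quotient.pi_add R ideal_zmod). Qed.

Lemma quot_mulA : associative quot_mul.
Proof.
move=> x y z; rewrite -[x]reprK -[y]reprK -[z]reprK.
by rewrite !pi_quot_mul mulrA.
Qed.

Lemma quot_mul1 : left_id quot_one quot_mul.
Proof. by move=> x; rewrite -[x]reprK pi_quot_mul mul1r. Qed.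

Lemma quot_mulr1 : right_id quot_one quot_mul.
Proof. by move=> x; rewrite -[x]reprK pi_quot_mul mulr1. Qed.

Lemma quot_mulDl : left_distributive quot_mul +%R.
Proof.
move=> x y z; rewrite -[x]reprK -[y]reprK -[z]reprK.
by rewrite !(pi_quot_add, pi_quot_mul) mulrDl.
Qed.

Lemma quot_mulDr : right_distributive quot_mul +%R.
Proof.
move=> x y z; rewrite -[x]reprK -[y]reprK -[z]reprK.
by rewrite !(pi_quot_add, pi_quot_mul) mulrDr.
Qed.

HB.instance Definition _ := GRing.Zmodule_isPzRing.Build quotient_ring
  quot_mulA quot_mul1 quot_mulr1 quot_mulDl quot_mulDr.

End QuotientRing.

(* The coefficients of a and b are indexed by all of M: those outside the
   supports are 0 and satisfy the conclusions trivially. *)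
Definition armendariz (M : monoidType) (R : pzRingType) : Prop :=
  forall a b : monoid_ring R M, a * b = 0 ->
    forall g h : M, mr_coef g a * mr_coef h b = 0.

Definition lower_nil_armendariz (M : monoidType) (R : pzRingType) : Prop :=
  forall a b : monoid_ring R M,
    mr_over (prime_radical [set: R]) (a * b) ->
    forall g h : M, prime_radical [set: R] (mr_coef g a * mr_coef h b).

(* Main.v *)
Require Import Defs.
From mathcomp Require Import all_boot all_order all_algebra.
From mathcomp Require Import boolp classical_sets.
From mathcomp Require Import finmap.
From mathcomp.multinomials Require Import monalg.

(** Write N for the prime radical of R. The theorem rests on two independent
    facts.

    First, I is reduced modulo N: an element t of I with t * t in N lies in N
    ([two_primal_reduced]). Such a t is nilpotent, since elements of N are
    ([prime_radical_nil]); as I is 2-primal, t lies in the prime radical of I;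
    and that radical is contained in N because each prime of R either contains
    I or meets I in a prime of I ([prime_ideal_restrict]).

    Second, the Armendariz property lifts along an ideal that is reduced modulo
    N ([armendariz_lift]). If alpha * beta has its coefficients in N, then it
    has them in I, so all a_g b_h lie in I because R / I is Armendariz
    ([armendariz_quotient]). To push a_g b_h from I into N, induct on (g h, g)
    in the lexicographic order. The coefficient of alpha * beta at g h is the
    sum of the a_g' b_h' with g' h' = g h. Those with g' < g are in N by
    induction. For those with g' > g, strictness of the order gives
    g h' < g' h' = g h, so a_g b_h' is in N by induction, and reducedness
    turns this into b_h' I a_g being contained in N ([reduced_mul_mid]).
    Multiplying the sum on the right by c * c, where c = a_g b_h is in I,
    therefore sends every term but the one at (g, h) into N; hence c * c * c is
    in N, and so is c. *)

Set Implicit Arguments.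
Unset Strict Implicit.
Unset Printing Implicit Defensive.

Import Order.TTheory GRing.Theory.

Local Open Scope classical_set_scope.
Local Open Scope ring_scope.

(** * Ideals and the prime radical *)

Section Ideals.
Context (R : pzRingType).
Implicit Types (A B I N P S : set R) (a b x y : R).

Lemma is_ideal0 S A : is_ideal S A -> A 0.
Proof. by case. Qed.

Lemma is_idealB S A a b : is_ideal S A -> A a -> A b -> A (a - b).
Proof. by case=> _ _ AB _; exact: AB. Qed.

Lemma is_idealD S A a b : is_ideal S A -> A a -> A b -> A (a + b).
Proof.
move=> idA Aa Ab; rewrite -[b]opprK; apply: (is_idealB idA) => //.
by rewrite -[- b]add0r; apply: (is_idealB idA); first exact: is_ideal0 idA.
Qed.

Lemma is_idealMl A s a : is_ideal setT A -> A a -> A (s * a).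
Proof. by case=> _ _ _ AM Aa; case: (AM s a). Qed.

Lemma is_idealMr A s a : is_ideal setT A -> A a -> A (a * s).
Proof. by case=> _ _ _ AM Aa; case: (AM s a). Qed.

Lemma is_ideal_sum S A (K : eqType) (s : seq K) (Q : pred K) (F : K -> R) :
  is_ideal S A -> {in s, forall i, Q i -> A (F i)} ->
  A (\sum_(i <- s | Q i) F i).
Proof.
move=> idA AF; rewrite big_seq_cond; apply: (@big_ind _ A).
- exact: is_ideal0 idA.
- by move=> x y; exact: is_idealD idA.
- by move=> i /andP[]; exact: AF.
Qed.

Lemma is_ideal_isolate S A (K : eqType) (s : seq K) (Q : pred K) (F : K -> R) i :
  is_ideal S A -> uniq s -> i \in s -> Q i ->
  A (\sum_(j <- s | Q j) F j) ->
  {in s, forall j, Q j -> j != i -> A (F j)} -> A (F i).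
Proof.
move=> idA us si Qi Asum AF.
have := Asum; rewrite big_mkcond (bigD1_seq i) //= Qi -big_mkcondr => AFi.
rewrite -[F i](addrK (\sum_(j <- s | (j != i) && Q j) F j)).
apply: (is_idealB idA) => //.
by apply: (is_ideal_sum idA) => j sj /andP[ji Qj]; exact: AF.
Qed.

(** The ideals generated by a and by b are replaced by larger ones that need
    no description of generators: A, the elements x with x R b inside P, and
    then B, the elements y with A R y inside P. Their product is in P by
    construction of B, with a in A by hypothesis and b in B by construction of A. *)
Lemma prime_ideal_elementwise P a b : is_prime_ideal setT P ->
  (forall r, P (a * r * b)) -> P a \/ P b.
Proof.
move=> [idP _ primeP] Parb.
pose A := [set x | forall r, P (x * r * b)].
pose B := [set y | forall x r, A x -> P (x * r * y)].
have idA : is_ideal setT A.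
  split=> // [r|x y Ax Ay r|s x _ Ax].
  - by rewrite !mul0r; exact: is_ideal0 idP.
  - by rewrite !mulrBl; exact: is_idealB idP _ _.
  - split=> r; last by rewrite -(mulrA x); exact: Ax.
    by rewrite -!mulrA; apply: is_idealMl => //; rewrite mulrA; exact: Ax.
have idB : is_ideal setT B.
  split=> // [x r _|y z By Bz x r Ax|s y _ By].
  - by rewrite mulr0; exact: is_ideal0 idP.
  - by rewrite mulrBr; apply: (is_idealB idP); [exact: By|exact: Bz].
  - split=> x r Ax; first by rewrite mulrA -(mulrA x); exact: By.
    by rewrite mulrA; apply: is_idealMr => //; exact: By.
case: (primeP A B idA idB) => [x y Ax By|AP|BP].
- by rewrite -[x]mulr1; exact: By.
- by left; exact: AP.
- by right; apply: BP => x r; exact.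
Qed.

Lemma prime_radical_ideal : is_ideal setT (prime_radical [set: R]).
Proof.
split=> // [|x y [_ Nx] [_ Ny]|s x _ [_ Nx]].
- by split=> // P [/is_ideal0].
- split=> // P pP; have [idP _ _] := pP.
  by apply: (is_idealB idP); [exact: Nx|exact: Ny].
- by split; split=> // P pP; have [idP _ _] := pP;
    [apply: is_idealMl|apply: is_idealMr] => //; exact: Nx.
Qed.

(** An ideal that is maximal among those containing no positive power of x is
    prime: if A and B are not inside P, then P + A and P + B contain powers of
    x, and the product of these two powers lies in P + A B. So a non-nilpotent
    x is missed by some prime. *)
Lemma prime_radical_nil x :
  prime_radical [set: R] x -> exists n, x ^+ n.+1 = 0.
Proof.
move=> [_ Nx]; apply: contrapT => nilx.
(* Zorn's lemma over unions includes the empty chain, whose union is set0: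
   [avoids] therefore does not ask for 0, which is recovered for P afterwards. *)
pose avoids A := [/\ forall a b, A a -> A b -> A (a - b),
  forall s a, A a -> A (s * a) /\ A (a * s) & forall n, ~ A (x ^+ n.+1)].
have [F Fav totF|P [[PB PM Px] maxP]] := @Zorn_bigcup R avoids.
  split.
  - move=> a b [X FX Xa] [Y FY Yb]; have [XY|YX] := totF _ _ FX FY.
      by exists Y => //; have [YB _ _] := Fav _ FY; apply: YB => //; exact: XY.
    by exists X => //; have [XB _ _] := Fav _ FX; apply: XB => //; exact: YX.
  - by move=> s a [X FX Xa]; have [_ /(_ s a Xa)[]] := Fav _ FX; split; exists X.
  - by move=> n [X FX]; have [_ _] := Fav _ FX; apply.
have P0 : P 0.
  apply: contrapT => nP0; apply: (maxP [set 0]).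
    split; last by move=> /(_ 0 erefl).
    by move=> a Pa; case: nP0; rewrite -(subrr a); exact: PB.
  split=> [a b -> ->|s a ->|n xn]; rewrite ?subr0 ?mulr0 ?mul0r //.
  by apply: nilx; exists n.
have idP : is_ideal setT P by split=> // s a _; exact: PM.
have meets A : is_ideal setT A -> ~ A `<=` P ->
    exists n p, P p /\ A (x ^+ n.+1 - p).
  move=> idA AP; apply: contrapT => nmeets.
  apply: (maxP [set y | exists2 p, P p & A (y - p)]).
    split=> [y Py|sub].
      by exists y => //; rewrite subrr; exact: is_ideal0 idA.
    by apply: AP => a Aa; apply: sub; exists 0; rewrite ?subr0.
  split.
  - move=> a b [p Pp Ap] [q Pq Aq]; exists (p - q); first exact: PB.
    by rewrite opprD addrACA -opprD; exact: is_idealB idA Ap Aq.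
  - move=> s a [p Pp Ap]; split.
      by exists (s * p); [case: (PM s p Pp)|rewrite -mulrBr; exact: is_idealMl].
    by exists (p * s); [case: (PM s p Pp)|rewrite -mulrBl; exact: is_idealMr].
  - by move=> n [p Pp Ap]; apply: nmeets; exists n, p.
suff pP : is_prime_ideal setT P by apply: (Px 0); rewrite expr1; exact: Nx.
split=> // [PT|A B idA idB PAB]; first by apply: (Px 0); rewrite PT.
have [AP|/(meets _ idA)[m [p [Pp Am]]]] := pselect (A `<=` P); first by left.
have [BP|/(meets _ idB)[n [q [Pq Bn]]]] := pselect (B `<=` P); first by right.
case: (Px (m + n).+1); rewrite -addSn -addnS exprD.
rewrite -[x ^+ m.+1](subrK p) mulrDl; apply: (is_idealD idP);
  last exact: is_idealMr.
rewrite -[x ^+ n.+1](subrK q) mulrDr; apply: (is_idealD idP);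
  last exact: is_idealMl.
exact: PAB.
Qed.

(** Ideals of I need not be ideals of R, so primeness of P is used on elements:
    with z in I but not in P and a in A but not in P, any b outside P would
    give r and s such that a * (r * z * s) * b is not in P; but r * z * s is in
    I, so a * (r * z * s) is in A and the product is in A B. *)
Lemma prime_ideal_restrict I P : is_ideal setT I -> is_prime_ideal setT P ->
  ~ I `<=` P -> is_prime_ideal I (I `&` P).
Proof.
move=> idI pP nIP; have [idP _ _] := pP; split.
- split=> [|||s a Is [Ia Pa]].
  + by move=> ? [].
  + by split; [exact: is_ideal0 idI|exact: is_ideal0 idP].
  + move=> a b [Ia Pa] [Ib Pb].
    by split; [exact: is_idealB idI _ _|exact: is_idealB idP _ _].
  + by split; split; do ?[exact: is_idealMl|exact: is_idealMr].
- by move=> IPI; apply: nIP => x; rewrite -{1}IPI => -[].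
move=> A B [AI _ _ AM] [BI _ _ _] PAB.
have [z [Iz nPz]] : exists z, I z /\ ~ P z.
  apply: contrapT => nz; apply: nIP => z Iz.
  by apply: contrapT => nPz; apply: nz; exists z.
have [|nA] := pselect (A `<=` I `&` P); [by left|right].
have [a [Aa nPa]] : exists a, A a /\ ~ P a.
  apply: contrapT => na; apply: nA => a Aa; split; first exact: AI.
  by apply: contrapT => nPa; apply: na; exists a.
move=> b Bb; split; first exact: BI.
have [r nPr] : exists r, ~ P (a * r * z).
  apply: contrapT => /forallNP nr.
  by case: (@prime_ideal_elementwise P a z pP) => // r; apply: contrapT.
case: (@prime_ideal_elementwise P (a * r * z) b pP) => // s.
have Irzs : I (r * z * s) by apply: is_idealMr => //; exact: is_idealMl.
have [_ Ars] := AM _ _ Irzs Aa.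
by have [_] := PAB _ _ Ars Bb; rewrite !mulrA.
Qed.

Lemma prime_radical_restrict I : is_ideal setT I ->
  prime_radical I `<=` prime_radical [set: R].
Proof.
move=> idI x [Ix Nx]; split=> // P pP.
have [IP|nIP] := pselect (I `<=` P); first exact: IP.
by case: (Nx _ (prime_ideal_restrict idI pP nIP)).
Qed.

Lemma two_primal_reduced I x : is_ideal setT I -> two_primal I ->
  I x -> prime_radical [set: R] (x * x) -> prime_radical [set: R] x.
Proof.
move=> idI primalI Ix /prime_radical_nil[n].
rewrite -expr2 -exprM => xn; apply: (prime_radical_restrict idI).
rewrite primalI; split=> //; exists (2 * n.+1).-1.
by rewrite prednK ?muln_gt0.
Qed.

End Ideals.

(** * Coefficients of products *)

(** The order on T need not be well-founded; the induction is along the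
    finitely many values that f takes on s. *)
Lemma seq_order_ind (d : Order.disp_t) (T : orderType d) (K : eqType)
    (f : K -> T) (s : seq K) (Q : K -> Prop) :
  {in s, forall x, {in s, forall y, (f y < f x)%O -> Q y} -> Q x} ->
  {in s, forall x, Q x}.
Proof.
move=> step x; have [n] := ubnP (count (fun y => f y < f x)%O s).
elim: n x => // n IHn x; rewrite ltnS => le_n sx; apply: step => // y sy lt_yx.
apply: IHn => //; apply: leq_trans le_n.
have sub : subpred (fun z => f z < f y)%O (fun z => f z < f x)%O.
  by move=> z /= /lt_trans; apply.
have /permP perm_s := perm_to_rem sy.
by rewrite !perm_s /= ltxx lt_yx add0n add1n ltnS sub_count.
Qed.

Section Coefficients.
Context (R : pzRingType) (M : monoidType).
Implicit Types (a b : monoid_ring R M) (D E : {fset M}).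

Lemma mr_coef_notin a k : k \notin msupp a -> mr_coef k a = 0.
Proof. exact: mcoeff_outdom. Qed.

Lemma mr_coefM a b D E k :
  (msupp a `<=` D)%fset -> (msupp b `<=` E)%fset ->
  mr_coef k (a * b) =
    \sum_(p <- [seq (g, h) | g <- D, h <- E] | (p.1 * p.2)%g == k)
      mr_coef p.1 a * mr_coef p.2 b.
Proof.
move=> aD bE; rewrite /mr_coef [a * b](mr_mulw aD bE) [RHS]big_mkcond big_allpairs.
rewrite raddf_sum; apply: eq_bigr => g _; rewrite raddf_sum; apply: eq_bigr => h _.
by rewrite /= mcoeffU mulrb.
Qed.

End Coefficients.

(** * Lifting along an ideal reduced modulo N *)

Section Armendariz.
Context (d : Order.disp_t) (M : strictlyOrderedMonoidType d) (R : pzRingType).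
Implicit Types (a b : monoid_ring R M).

Lemma ordered_mulgI (g : M) : injective (fun h => (g * h)%g).
Proof.
move=> h h' /= eq_gh; apply/eqP; case: ltgtP => // lt_h.
- by have := ltM2l g _ _ lt_h; rewrite eq_gh ltxx.
- by have := ltM2l g _ _ lt_h; rewrite eq_gh ltxx.
Qed.

(** The square of y * z * x contains the factor x * y, and y * z * x is in I
    because z is, although y * x itself need not be. *)
Lemma reduced_mul_mid (I N : set R) x y z :
  is_ideal setT I -> is_ideal setT N ->
  (forall t, I t -> N (t * t) -> N t) ->
  N (x * y) -> I z -> N (y * z * x).
Proof.
move=> idI idN redI Nxy Iz; apply: redI.
  by apply: is_idealMr => //; exact: is_idealMl.
rewrite !mulrA -(mulrA (y * z) x y).
by do 2!apply: is_idealMr => //; exact: is_idealMl.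
Qed.

(** By lexicographic induction on (g h, g): among the terms of the coefficient
    at g h, those with g' < g are in N by induction, and right multiplication
    by the square of c = a_g b_h puts those with g' > g in N, since it exposes
    a factor b_h' c a_g. *)
Lemma armendariz_lift (I N : set R) a b :
  is_ideal setT I -> is_ideal setT N ->
  (forall t, I t -> N (t * t) -> N t) ->
  (forall g h, I (mr_coef g a * mr_coef h b)) ->
  mr_over N (a * b) -> forall g h, N (mr_coef g a * mr_coef h b).
Proof.
move=> idI idN redI Iab Nab.
pose s := [seq (g, h) | g <- msupp a, h <- msupp b].
pose lex (p : M * M) : M *lexi[d] M := ((p.1 * p.2)%g, p.1).
have us : uniq s.
  by apply: allpairs_uniq => // -[? ?] [? ?] _ _ /=.
suff Ns : {in s, forall p, N (mr_coef p.1 a * mr_coef p.2 b)}.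
  move=> g h; case: (boolP (g \in msupp a)) => [ga|/mr_coef_notin->]; last first.
    by rewrite mul0r; exact: is_ideal0 idN.
  case: (boolP (h \in msupp b)) => [hb|/mr_coef_notin->]; last first.
    by rewrite mulr0; exact: is_ideal0 idN.
  by apply: (Ns (g, h)); apply: allpairs_f.
apply: (seq_order_ind (f := lex)) => -[g h] sgh IH /=.
set c := mr_coef g a * mr_coef h b.
have Ic : I c by exact: Iab.
(* c ^ 3 in N gives c ^ 4 in N, and two square roots inside I give c. *)
suff Nccc : N (c * c * c).
  apply: (redI) => //; apply: (redI); first exact: is_idealMl.
  by rewrite mulrA; apply: is_idealMr.
have := Nab (g * h)%g.
rewrite (mr_coefM _ (fsubset_refl _) (fsubset_refl _)) -/s.
move=> /(is_idealMr c idN)/(is_idealMr c idN); rewrite !mulr_suml => Nsum.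
apply: (is_ideal_isolate (i := (g, h))
  (F := fun p => mr_coef p.1 a * mr_coef p.2 b * c * c) idN us sgh _ Nsum)
  => //= -[g' h'] sp /eqP eqw neq /=.
case: (ltgtP g' g) => [lt_g|lt_g|eq_g].
- do 2!apply: is_idealMr => //; apply: (IH (g', h')) => //.
  by rewrite ltxi_pair /= eqw lexx.
- have Nbca : N (mr_coef h' b * c * mr_coef g a).
    apply: reduced_mul_mid idI idN redI _ Ic.
    apply: (IH (g, h')).
      have /allpairsP[[? ?] [ga _ [-> _]]] := sgh.
      have /allpairsP[[? ?] [_ hb [_ ->]]] := sp.
      exact: allpairs_f.
    have lt_w := ltM2r h' _ _ lt_g.
    by rewrite ltxi_pair /= -eqw (ltW lt_w) (lt_geF lt_w).
  have -> : mr_coef g' a * mr_coef h' b * c * c =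
      mr_coef g' a * (mr_coef h' b * c * mr_coef g a) * mr_coef h b.
    by rewrite /c !mulrA.
  by apply: is_idealMr => //; exact: is_idealMl.
- by case/eqP: neq; move: eqw; rewrite eq_g /= => /ordered_mulgI ->.
Qed.

End Armendariz.

(** * Passing to the quotient ring *)

Section Quotient.
Context (M : monoidType) (R : pzRingType) (I : two_sided_ideal R).
Implicit Types (a b : monoid_ring R M).
Local Notation Q := (quotient_ring I).
Local Open Scope quotient_scope.

Lemma pi_quot0 : \pi_Q 0 = 0 :> Q.
Proof. by apply: (addIr (\pi_Q 0)); rewrite pi_quot_add !add0r. Qed.

Lemma pi_quot_eq0 (x : R) : \pi_Q x = 0 :> Q <-> ideal_set I x.
Proof. by rewrite -pi_quot0 quot_eqE subr0. Qed.

Definition mr_pi a : monoid_ring Q M :=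
  [malg k in msupp a => \pi_Q (mr_coef k a)].

Lemma mr_coef_pi a k : mr_coef k (mr_pi a) = \pi_Q (mr_coef k a).
Proof.
rewrite /mr_coef /mr_pi mcoeffE; case: ifPn => // /mcoeff_outdom ->.
by rewrite pi_quot0.
Qed.

Lemma msupp_pi a : (msupp (mr_pi a) `<=` msupp a)%fset.
Proof.
apply/fsubsetP => k; rewrite -mcoeff_neq0; apply: contraNT => ka.
by apply/eqP; rewrite [LHS]mr_coef_pi (mr_coef_notin ka) pi_quot0.
Qed.

Lemma armendariz_quotient a b :
  armendariz M Q -> mr_over I (a * b) ->
  forall g h, ideal_set I (mr_coef g a * mr_coef h b).
Proof.
move=> armQ Iab g h; apply/pi_quot_eq0; rewrite -pi_quot_mul -!mr_coef_pi.
apply: armQ; apply/malgP => k; rewrite mcoeff0.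
rewrite [LHS](mr_coefM k (msupp_pi a) (msupp_pi b)).
under eq_bigr do rewrite !mr_coef_pi [_ * _]pi_quot_mul.
have /pi_quot_eq0 piab0 := Iab k; rewrite -[RHS]piab0.
rewrite (mr_coefM k (fsubset_refl _) (fsubset_refl _)).
apply/esym/(big_morph (\pi_Q)) => [x y|]; first by rewrite pi_quot_add.
exact: pi_quot0.
Qed.

End Quotient.

Theorem theorem3p1 (d : Order.disp_t) (M : strictlyOrderedMonoidType d)
    (R : pzRingType) (I : two_sided_ideal R)
    (properI : ideal_set I <> [set: R])
    (subNI : prime_radical [set: R] `<=` I)
    (armRI : armendariz M (quotient_ring I))
    (primalI : two_primal I) :
  lower_nil_armendariz M R.
Proof.
move=> a b Nab; have idI := ideal_setP I.
apply: (armendariz_lift idI (@prime_radical_ideal R)) (Nab).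
  by move=> t; exact: two_primal_reduced.
by apply: armendariz_quotient armRI _ => k; exact/subNI/Nab.
Qed.
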